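(* There exists an absolute constant $c>0$ such that the following hold. (1) For every $d\in\mathbb{N}$ and every $p\in[1,\infty]$, the competitive ratio of nested convex body chasing over $\ell_p^d=(\mathbb{R}^d,\|\cdot\|_p)$ satisfies $\hat R(\ell_p^d)\ \ge\ c\,\max\big(d^{\,1-1/p},\sqrt d\big)$ (with $1/\infty=0$); that is, no deterministic online algorithm achieves a competitive ratio smaller than $c\max(d^{1-1/p},\sqrt d)$. (2) For every $d\in\mathbb{N}$ and every norm $\|\cdot\|$ on $\mathbb{R}^d$, the competitive ratio of nested convex body chasing over $(\mathbb{R}^d,\|\cdot\|)$ satisfies $\hat R(\mathbb{R}^d,\|\cdot\|)\ \ge\ c\,d^{1/6}$.
   Context: Nested convex body chasing over a normed space $(\mathbb{R}^d,\|\cdot\|)$: an online player starts at $x_0=0$. At each time $t=1,\dots,T$ (with $T\in\mathbb{N}$ finite, not known in advance) a convex body $K_t\subseteq\mathbb{R}^d$ is revealed, where the requests are nested, $K_1\supseteq K_2\supseteq\dots\supseteq K_T$. Here a convex body is a nonempty compact convex subset of $\mathbb{R}^d$ (empty interior is allowed). A deterministic online algorithm $\mathcal{A}$ is a rule choosing $x_t=\mathcal{A}_t(K_1,\dots,K_t)\in K_t$ depending only on the requests revealed so far. Its cost is $\mathrm{cost}_T(x_1,\dots,x_T)=\sum_{t=1}^T\|x_t-x_{t-1}\|$, and the offline optimum is $\mathrm{opt}_T(K_1,\dots,K_T)=\min\{\sum_{t=1}^T\|y_t-y_{t-1}\| : y_t\in K_t\ \forall t\in\{1,\dots,T\}\}$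 with $y_0=x_0=0$. The competitive ratio of $\mathcal{A}$ is $C(\mathcal{A})=\sup \mathrm{cost}_T/\mathrm{opt}_T\in[0,\infty]$, the supremum being over all $T$ and all nested request sequences (conventions: $0/0=0$ and $a/0=\infty$ for $a>0$). Finally $\hat R(\mathbb{R}^d,\|\cdot\|)=\inf_{\mathcal{A}}C(\mathcal{A})$ over all deterministic online algorithms for the nested problem. *)

(* Defs.v *)
From HB Require Import structures.
From mathcomp Require Import all_boot all_order all_algebra.
From mathcomp Require Import all_classical all_reals all_analysis.
Set Implicit Arguments.
Unset Strict Implicit.
Unset Printing Implicit Defensive.
Import Order.TTheory GRing.Theory Num.Theory.
Import numFieldNormedType.Exports.
Local Open Scope classical_set_scope.
Local Open Scope ring_scope.

Definition is_norm (R : realType) (d : nat) (N : 'rV[R]_d -> R) : Prop :=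
  [/\ forall x y, N (x + y) <= N x + N y,
      forall a x, N (a *: x) = `|a| * N x
    & forall x, N x = 0 -> x = 0].

(* The value at p = -oo is irrelevant: only 1 <= p is ever used. *)
Definition lp_norm (R : realType) (d : nat) (p : \bar R) (x : 'rV[R]_d) : R :=
  match p with
  | EFin r => (\sum_(i < d) `|x 0 i| `^ r) `^ r^-1
  | +oo%E => \big[Num.max/0]_(i < d) `|x 0 i|
  | -oo%E => 0
  end.

(* Compactness is for the product topology of 'rV[R]_d, which is the topology
   of every norm on R^d. *)
Definition convex_body (R : realType) (d : nat) (K : set 'rV[R]_d) : Prop :=
  [/\ K !=set0, compact K & @convex_set R 'rV[R]_d K].

(* A request sequence K_1, ..., K_T is a list ks with T = size ks, so that
   K_(t.+1) is nth set0 ks t. *)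
Definition nested_requests (R : realType) (d : nat)
    (ks : seq (set 'rV[R]_d)) : Prop :=
  (forall t, (t < size ks)%N -> convex_body (nth set0 ks t)) /\
  (forall t, (t.+1 < size ks)%N -> nth set0 ks t.+1 `<=` nth set0 ks t).

(* A maps the list K_1, ..., K_t of the requests revealed so far to x_t; its
   values on the empty list and on non-nested lists are irrelevant. *)
Definition online_algorithm (R : realType) (d : nat)
    (A : seq (set 'rV[R]_d) -> 'rV[R]_d) : Prop :=
  forall ks, (0 < size ks)%N -> nested_requests ks -> last set0 ks (A ks).

Definition trajectory (R : realType) (d : nat)
    (A : seq (set 'rV[R]_d) -> 'rV[R]_d) (ks : seq (set 'rV[R]_d))
    (t : nat) : 'rV[R]_d :=
  if t is 0%N then 0 else A (take t ks).

Definition path_cost (R : realType) (d : nat) (N : 'rV[R]_d -> R)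
    (T : nat) (x : nat -> 'rV[R]_d) : R :=
  \sum_(t < T) N (x t.+1 - x t).

Definition feasible (R : realType) (d : nat) (ks : seq (set 'rV[R]_d))
    (y : nat -> 'rV[R]_d) : Prop :=
  y 0%N = 0 /\ forall t, (t < size ks)%N -> nth set0 ks t (y t.+1).

(* The infimum is a minimum: see opt_attained. *)
Definition opt (R : realType) (d : nat) (N : 'rV[R]_d -> R)
    (ks : seq (set 'rV[R]_d)) : R :=
  inf [set path_cost N (size ks) y | y in feasible ks].

Lemma opt_attained (R : realType) (d : nat) (N : 'rV[R]_d -> R)
    (ks : seq (set 'rV[R]_d)) :
  is_norm N -> nested_requests ks ->
  exists2 y, feasible ks y & opt N ks = path_cost N (size ks) y.
Proof.
move=> [ND NZ _] [bks _].
have N0 : N 0 = 0 by rewrite -(scale0r 0) NZ normr0 mul0r.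
have NN x : N (- x) = N x by rewrite -scaleN1r NZ normrN1 mul1r.
have Nge0 x : 0 <= N x.
  by have := ND x (- x); rewrite subrr N0 NN -mulr2n pmulrn_lge0.
pose C := 1 + \sum_(i < d) N (delta_mx 0 i).
have C0 : 0 < C by rewrite ltr_pwDl// sumr_ge0.
have NC x : N x <= C * `|x|.
  rewrite {1}(row_sum_delta x) mulrDl mul1r.
  have : N (\sum_(j < d) x 0 j *: delta_mx 0 j)
      <= \sum_(j < d) N (x 0 j *: delta_mx 0 j).
    elim/big_ind2 : _ => [|a b a' b' h h'|//]; first by rewrite N0.
    exact: le_trans (ND _ _) (lerD h h').
  move=> /le_trans; apply; rewrite mulr_suml -[leLHS]add0r lerD//.
  apply: ler_sum => i _; rewrite NZ mulrC ler_wpM2l//.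
  by rewrite [leRHS]mx_normrE (le_bigmax _ _ (0, i)).
have Ndist x y : `|N x - N y| <= N (x - y).
  have h u v : N u - N v <= N (u - v) by rewrite lerBlDr -{1}(subrK v u).
  by rewrite ler_norml h andbT lerNl opprB -(NN (x - y)) opprB h.
have cN : continuous N.
  move=> x; have FF : Filter (nbhs x) := nbhs_filter x.
  apply/(@cvgrPdist_lt _ _ _ (nbhs x) FF) => e e0.
  apply/nbhs_ballP; exists (e / C) => /=; first exact: divr_gt0.
  move=> y; rewrite -ball_normE /= ltr_pdivlMr// mulrC => xy.
  exact: le_lt_trans (le_trans (Ndist _ _) (NC _)) xy.
pose K t : set 'rV[R]_d :=
  if t is s.+1 then if (s < size ks)%N then nth set0 ks s else [set 0]
  else [set 0].
pose F := [set y : prod_topology (fun _ : nat => 'rV[R]_d) | forall t, K t (y t)].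
have cK t : compact (K t).
  case: t => [|s] /=; first exact: compact_set1.
  by case: ifPn => [/bks[]//|_]; exact: compact_set1.
have K0 t : exists v, K t v.
  case: t => [|s] /=; first by exists 0.
  by case: ifPn => [/bks[]//|_]; exists 0.
have F0 : F !=set0.
  by have [y yK] := choice K0; exists y.
have cF : compact F by exact: tychonoff.
have cc : continuous (path_cost N (size ks) : prod_topology _ -> R).
  move=> y; have FF : Filter (nbhs y) := nbhs_filter y.
  have pr t : (z t : 'rV[R]_d) @[z --> y] --> (y t : 'rV[R]_d).
    exact: (@proj_continuous _ (fun _ : nat => 'rV[R]_d)).
  rewrite /path_cost; apply: (cvg_big _ FF) => [|i _].
    exact: add_continuous.
  apply: (@cvg_comp _ _ _ (fun z : prod_topology _ => z i.+1 - z i) N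
    (nbhs y) (nbhs (y i.+1 - y i))); last exact: cN.
  exact: (@cvgB _ _ _ _ FF _ _ _ _ (pr _) (pr _)).
have [y /set_mem yF ymin] := compact_EVT_min F0 cF (continuous_subspaceT cc).
have yfeas : feasible ks y.
  split=> [|t tks]; first exact: (yF 0%N).
  by have := yF t.+1; rewrite /K tks.
have lbz z : feasible ks z -> path_cost N (size ks) y <= path_cost N (size ks) z.
  move=> [z0 zk].
  pose z' t := if (t <= size ks)%N then z t else 0.
  have -> : path_cost N (size ks) z = path_cost N (size ks) z'.
    by apply: eq_bigr => i _; rewrite /z' ltn_ord ltnW.
  apply: ymin; apply/mem_set => -[|t] /=; first by rewrite /z'.
  by rewrite /z'; case: ifPn => // /zk.
exists y => //; apply/eqP; rewrite eq_le; apply/andP; split.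
  apply: ge_inf; last by exists y.
  by exists (path_cost N (size ks) y) => _ [z zf <-]; exact: lbz.
apply: lb_le_inf; first by exists (path_cost N (size ks) y); exists y.
by move=> _ [z zf <-]; exact: lbz.
Qed.

(* Division in \bar R satisfies 0 / 0 = 0 and a / 0 = +oo for a > 0. *)
Definition competitive_ratio (R : realType) (d : nat) (N : 'rV[R]_d -> R)
    (A : seq (set 'rV[R]_d) -> 'rV[R]_d) : \bar R :=
  ereal_sup [set ((path_cost N (size ks) (trajectory A ks))%:E
                  / (opt N ks)%:E)%E | ks in @nested_requests R d].

Definition nested_chasing_ratio (R : realType) (d : nat)
    (N : 'rV[R]_d -> R) : \bar R :=
  ereal_inf [set competitive_ratio N A | A in @online_algorithm R d].

(* Main.v *)
Require Import Defs.
From mathcomp Require Import all_boot all_order all_algebra.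
From mathcomp Require Import all_classical all_reals all_analysis.
From mathcomp Require Import ring lra zify.
Set Implicit Arguments.
Unset Strict Implicit.
Unset Printing Implicit Defensive.
Import Order.TTheory GRing.Theory Num.Theory.
Import numFieldNormedType.Exports.
Local Open Scope classical_set_scope.
Local Open Scope ring_scope.

(** Let f_1, ..., f_n be functionals of dual norm at most 1 such that every sign
    pattern (f_i x = e_i for all i) has a solution of norm at most B.  Revealing
    f_t x = e_t at time t, with e_t opposite to the sign of f_t at the current
    position, costs the player at least n, while the offline player pays at most
    B; so the competitive ratio is at least n / B.

    In l_p the coordinates give d^(1 - 1/p).  For p <= 2 the rows of a Hadamard
    matrix of order n = 2^k, d / 2 < n <= d, normalized in the dual norm, have
    B = sqrt n.

    For a general norm N choose coordinates in which the Euclidean ball is an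
    ellipsoid of maximal volume in the unit ball of N.  First-order optimality
    provides, for each matrix A of positive trace, a unit vector x with
    x A x^T >= 0 that is (nearly) a contact point, so that <x, .> has dual norm
    at most 2.  With A = 2t/d - sum_(i < t) u_i^T u_i one finds successively unit
    vectors u_t with sum_(i < t) <u_t, u_i>^2 <= 2t/d.  For n of order sqrt d
    their Gram matrix is well conditioned, hence B = O(sqrt n). *)

(** * Dot products and determinants *)

Definition dotr (R : realType) (d : nat) (x y : 'rV[R]_d) : R :=
  (x *m y^T) 0 0.

Section DotProduct.
Context (R : realType) (d : nat).
Implicit Types (x y z : 'rV[R]_d) (a : R) (M : 'M[R]_d).

Lemma dotrE x y : dotr x y = \sum_i x 0 i * y 0 i.
Proof. by rewrite /dotr mxE; apply: eq_bigr => i _; rewrite mxE. Qed.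

Lemma dotrC x y : dotr x y = dotr y x.
Proof. by rewrite !dotrE; apply: eq_bigr => i _; rewrite mulrC. Qed.

Lemma dotrDl x y z : dotr (x + y) z = dotr x z + dotr y z.
Proof. by rewrite /dotr mulmxDl mxE. Qed.

Lemma dotrZl a x z : dotr (a *: x) z = a * dotr x z.
Proof. by rewrite /dotr -scalemxAl mxE. Qed.

Lemma dotrDr x y z : dotr x (y + z) = dotr x y + dotr x z.
Proof. by rewrite !(dotrC x) dotrDl. Qed.

Lemma dotrZr a x z : dotr x (a *: z) = a * dotr x z.
Proof. by rewrite !(dotrC x) dotrZl. Qed.

Lemma dotr_sumr x (n : nat) (F : 'I_n -> 'rV[R]_d) :
  dotr x (\sum_i F i) = \sum_i dotr x (F i).
Proof.
by rewrite /dotr linear_sum mulmx_sumr summxE.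
Qed.

Lemma dotr_ge0 x : 0 <= dotr x x.
Proof. by rewrite dotrE sumr_ge0// => i _; rewrite -expr2 sqr_ge0. Qed.

Lemma dotr_eq0 x : (dotr x x == 0) = (x == 0).
Proof.
apply/idP/eqP => [|->]; last by rewrite /dotr mul0mx mxE.
rewrite dotrE psumr_eq0 => [/allP h|i _]; last by rewrite -expr2 sqr_ge0.
apply/rowP => i; rewrite mxE; apply/eqP.
by have := h i (mem_index_enum _); rewrite mulf_eq0 orbb.
Qed.

Lemma dotr_gt0 x : (0 < dotr x x) = (x != 0).
Proof. by rewrite lt0r dotr_ge0 dotr_eq0 andbT. Qed.

Lemma dotr_delta_mx i : dotr (delta_mx 0 i : 'rV[R]_d) (delta_mx 0 i) = 1.
Proof. by rewrite /dotr trmx_delta mul_delta_mx mxE !eqxx. Qed.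

End DotProduct.

Lemma cauchy_schwarz_sum (R : realType) (I : finType) (a b : I -> R) :
  (\sum_i a i * b i) ^+ 2 <= (\sum_i a i ^+ 2) * (\sum_i b i ^+ 2).
Proof.
set A := \sum_i a i ^+ 2; set B := \sum_i b i ^+ 2; set C := \sum_i a i * b i.
have A0 : 0 <= A by rewrite sumr_ge0// => i _; rewrite sqr_ge0.
have h : 0 <= \sum_i (A * b i - C * a i) ^+ 2.
  by rewrite sumr_ge0// => i _; rewrite sqr_ge0.
have : \sum_i (A * b i - C * a i) ^+ 2 = A * (A * B - C ^+ 2).
  under eq_bigr do rewrite sqrrB !exprMn.
  rewrite big_split/= sumrB -!mulr_sumr -/A -/B.
  rewrite (eq_bigr (fun i => (A * C *+ 2) * (a i * b i))) => [|i _]; last by ring.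
  by rewrite -mulr_sumr -/C; ring.
move=> e; rewrite e in h.
move: A0; rewrite le0r => /orP[/eqP A0|A0]; last first.
  by rewrite pmulr_rge0// subr_ge0 in h.
have a0 i : a i = 0.
  have /(_ i isT) := psumr_eq0P (fun j _ => sqr_ge0 (a j)) A0.
  by move/eqP; rewrite sqrf_eq0 => /eqP.
rewrite (_ : C = 0) ?expr0n/=; last by rewrite /C big1// => i _; rewrite a0 mul0r.
by rewrite A0 mul0r.
Qed.

(** Cauchy-Schwarz on each column of [B] gives the squared Frobenius norm as constant; adding 1
    makes both division by [C] and [C <= C ^+ 2] available. *)
Lemma dotr_mulmx_le (R : realType) (d : nat) (B : 'M[R]_d) :
  exists2 C : R, 1 <= C & forall x, dotr (x *m B) (x *m B) <= C * dotr x x.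
Proof.
exists (1 + \sum_j \sum_i B i j ^+ 2) => [|x].
  by rewrite lerDl sumr_ge0// => j _; rewrite sumr_ge0// => i _; rewrite sqr_ge0.
rewrite mulrDl mul1r -[leLHS]add0r lerD ?dotr_ge0// mulr_suml dotrE.
apply: ler_sum => j _; rewrite -expr2 mxE mulrC dotrE.
under [X in _ <= X * _]eq_bigr do rewrite -expr2.
exact: cauchy_schwarz_sum.
Qed.

(* det (1 + eta B) is the reversed characteristic polynomial of - B, hence
   equals 1 + eta tr B + O(eta^2). *)
Lemma det_perturb (R : realType) (d : nat) (B : 'M[R]_d) : 0 < \tr B ->
  exists2 e : R, 0 < e &
    forall eta : R, 0 < eta -> eta <= e -> 1 < \det (1%:M + eta *: B).
Proof.
case: d B => [B|d B trB]; first by rewrite /mxtrace big_ord0 ltxx.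
pose p := char_poly (- B).
pose S : R := 1 + \sum_(k < d) `|p`_k|.
have S0 : 0 < S by rewrite ltr_pwDl// sumr_ge0.
exists (Num.min 1 (\tr B / (2 * S))).
  by rewrite lt_min ltr01 divr_gt0// mulr_gt0.
move=> eta eta0; rewrite le_min => /andP[eta1 etaS].
have -> : \det (1%:M + eta *: B) = eta ^+ d.+1 * p.[eta^-1].
  rewrite -[p.[_]]/(horner_eval _ p) /p /char_poly -det_map_mx -detZ.
  congr (\det _).
  apply/matrixP => i j; rewrite !mxE.
  rewrite [X in _ = _ * X](_ : _ = ('X *+ (i == j) - (- B i j)%:P).[eta^-1])//.
  rewrite hornerD hornerN hornerMn hornerX hornerC.
  by rewrite opprK mulrDr mulrnAr divff ?(gt_eqF eta0).
have sp : size p = d.+2 by rewrite size_char_poly.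
rewrite horner_coef sp !big_ord_recr/=.
have -> : p`_d.+1 = 1.
  by have /eqP := char_poly_monic (- B); rewrite lead_coefE -/p sp.
have -> : p`_d = \tr B.
  by rewrite (char_poly_trace (- B) (ltn0Sn d)) linearN opprK.
rewrite mulrDr mulrDr mul1r -exprMn divff ?(gt_eqF eta0)// expr1n.
rewrite exprS -!mulrA [X in _ + eta * X + _](_ : _ = \tr B); last first.
  by rewrite mulrCA -exprMn divff ?(gt_eqF eta0)// expr1n mulr1.
rewrite ltrDr.
(* Each lower coefficient carries [eta ^+ (d - i)], at most [eta] because [i < d] and [eta <= 1].
   Together they cost at most [eta * S], hence at most half of [\tr B]. *)
have h : - (eta * S) <= eta ^+ d * (\sum_(i < d) p`_i * eta^-1 ^+ i).
  rewrite lerNl mulr_sumr -sumrN mulrDr mulr1 -[leLHS]add0r.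
  apply: lerD; first exact: ltW.
  rewrite mulr_sumr; apply: ler_sum => i _; rewrite mulrCA -mulrN.
  have -> : eta ^+ d * eta^-1 ^+ i = eta ^+ (d - i).
    by rewrite exprVn -expfB.
  apply: le_trans (ler_norm _) _; rewrite normrM normrN mulrC.
  rewrite (ger0_norm (exprn_ge0 _ (ltW eta0))); apply: ler_wpM2r => //.
  have : (0 < d - i)%N by rewrite subn_gt0.
  case: (d - i)%N => // m _.
  by rewrite exprS ler_piMr ?(ltW eta0)// exprn_ile1// (ltW eta0).
rewrite -mulrDr pmulr_rgt0//.
rewrite ler_pdivlMr ?mulr_gt0// in etaS.
by nra.
Qed.

(** * Seminorms on row vectors *)

Section Seminorm.
Context (R : realType) (d : nat) (p : 'rV[R]_d -> R).
Context (pD : forall x y, p (x + y) <= p x + p y).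
Context (pZ : forall a x, p (a *: x) = `|a| * p x).

Lemma seminorm0 : p 0 = 0.
Proof. by rewrite -(scale0r 0) pZ normr0 mul0r. Qed.

Lemma seminormN x : p (- x) = p x.
Proof. by rewrite -scaleN1r pZ normrN1 mul1r. Qed.

Lemma seminorm_ge0 x : 0 <= p x.
Proof.
by have := pD x (- x); rewrite subrr seminorm0 seminormN -mulr2n pmulrn_lge0.
Qed.

Lemma seminorm_dist x y : `|p x - p y| <= p (x - y).
Proof.
have h u v : p u - p v <= p (u - v) by rewrite lerBlDr -{1}(subrK v u).
by rewrite ler_norml h andbT lerNl opprB -(seminormN (x - y)) opprB h.
Qed.

Lemma seminorm_le_norm : exists2 C : R, 0 < C & forall x, p x <= C * `|x|.
Proof.
exists (1 + \sum_(i < d) p (delta_mx 0 i)) => [|x].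
  by rewrite ltr_pwDl// sumr_ge0// => i _; exact: seminorm_ge0.
rewrite {1}(row_sum_delta x) mulrDl mul1r -[leLHS]add0r; apply: lerD => //.
rewrite mulr_suml; apply: (@le_trans _ _ (\sum_(j < d) p (x 0 j *: delta_mx 0 j))).
  elim/big_ind2 : _ => [|a b a' b' h h'|//]; first by rewrite seminorm0.
  by rewrite (le_trans (pD _ _))// lerD.
apply: ler_sum => i _; rewrite pZ mulrC ler_wpM2l ?seminorm_ge0//.
by rewrite [leRHS]mx_normrE (le_bigmax _ _ (0, i)).
Qed.

(** Besides norms, this serves for [v |-> N (x *m vec_mx v)] on flattened matrices, which can vanish
    at a nonzero [v]. *)
Lemma seminorm_continuous : continuous p.
Proof.
have [C C0 pC] := seminorm_le_norm.
move=> x; have FF : Filter (nbhs x) := nbhs_filter x.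
apply/(@cvgrPdist_lt _ _ _ (nbhs x) FF) => e e0.
apply/nbhs_ballP; exists (e / C) => /=; first exact: divr_gt0.
move=> y; rewrite -ball_normE /= ltr_pdivlMr// mulrC => xy.
exact: le_lt_trans (le_trans (seminorm_dist _ _) (pC _)) xy.
Qed.

End Seminorm.

(** * Compactness, continuity and comparison with the Euclidean norm *)

Lemma compact_box (R : realType) (k : nat) (L : R) :
  compact [set x : 'rV[R]_k | forall i, `|x 0 i| <= L].
Proof.
rewrite (_ : mkset _ =
    [set x : 'rV[R]_k | forall i, `[- L, L]%classic (x ord0 i)]).
  by apply: (@rV_compact _ _ (fun=> `[- L, L]%classic)) => _; exact: segment_compact.
by apply/seteqP; split=> x /= h i; have := h i; rewrite /= in_itv/= ler_norml.
Qed.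

Lemma dotr_continuous (R : realType) (d : nat) :
  continuous (fun x : 'rV[R]_d => dotr x x).
Proof.
rewrite (_ : (fun _ => _) = (fun x : 'rV[R]_d => \sum_i x 0 i * x 0 i)); last first.
  by apply/funext => x; rewrite dotrE.
apply: continuous_big => [|i _ x]; first exact: add_continuous.
by apply: continuousM; exact: coord_continuous.
Qed.

Lemma det_vec_mx_continuous (R : realType) (d : nat) :
  continuous (fun v : 'rV[R]_(d * d) => \det (vec_mx v)).
Proof.
apply: continuous_big => [|s _ v]; first exact: add_continuous.
have pc (f : 'I_d -> 'I_d) :
    continuous (fun v : 'rV[R]_(d * d) => \prod_i vec_mx v i (f i)).
  apply: continuous_big => [|i _]; first exact: mul_continuous.
  rewrite (_ : (fun _ => _) = (fun v : 'rV[R]_(d * d) => v 0 (mxvec_index i (f i)))).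
    exact: coord_continuous.
  by apply/funext => w; rewrite mxE.
exact: (continuousM (@cst_continuous _ _ _ v) (pc _ v)).
Qed.

Lemma sqr_dotr_coord (R : realType) (d : nat) (x : 'rV[R]_d) i :
  x 0 i ^+ 2 <= dotr x x.
Proof.
rewrite dotrE (bigD1 i)//= expr2 lerDl sumr_ge0// => j _.
by rewrite -expr2 sqr_ge0.
Qed.

Lemma normr_le_sqr (R : realType) (a b : R) : a ^+ 2 <= b -> `|a| <= 1 + b.
Proof.
move=> ab; have b0 : 0 <= b := le_trans (sqr_ge0 a) ab.
have : `|a| ^+ 2 <= b by rewrite real_normK ?num_real.
have := normr_ge0 a; nra.
Qed.

(** By compactness [N] attains its minimum on the Euclidean sphere, which is positive by
    definiteness; [m] is its square, and homogeneity does the rest. *)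
Lemma norm_ge_euclidean (R : realType) (d : nat) (N : 'rV[R]_d -> R) :
  (0 < d)%N -> is_norm N ->
  exists2 m : R, 0 < m & forall x, m * dotr x x <= N x ^+ 2.
Proof.
move=> d0 [ND NZ Ndef]; pose S := [set x : 'rV[R]_d | dotr x x = 1].
have S0 : S !=set0 by exists (delta_mx 0 (Ordinal d0)); exact: dotr_delta_mx.
have cS : compact S.
  apply: (subclosed_compact _ (@compact_box R d 2)).
    exact: (proj1 (continuous_closedP _) (@dotr_continuous R d) _ (@closed_eq _ _)).
  move=> x Sx i; apply: (@le_trans _ _ (1 + 1)); last by lra.
  by apply: normr_le_sqr; rewrite -Sx; exact: sqr_dotr_coord.
have [x0 /set_mem Sx0 xmin] :=
  compact_EVT_min S0 cS (continuous_subspaceT (seminorm_continuous ND NZ)).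
have Nx0 : 0 < N x0.
  rewrite lt0r seminorm_ge0// andbT; apply/eqP => /Ndef x00.
  by move: Sx0; rewrite /S/= x00 /dotr mul0mx mxE => /esym/eqP; rewrite oner_eq0.
exists (N x0 ^+ 2); first exact: exprn_gt0.
move=> x; have [->|x_neq0] := eqVneq x 0.
  by rewrite /dotr mul0mx mxE mulr0 sqr_ge0.
have xx : 0 < dotr x x by rewrite dotr_gt0.
pose s := Num.sqrt (dotr x x).
have s0 : 0 < s by rewrite sqrtr_gt0.
have s2 : s ^+ 2 = dotr x x by rewrite sqr_sqrtr// ltW.
have := xmin (s^-1 *: x); rewrite inE/= NZ gtr0_norm ?invr_gt0//.
rewrite /S/= dotrZl dotrZr -s2 mulrA -invfM -expr2 mulVf ?sqrf_eq0 ?gt_eqF//.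
move=> /(_ erefl); rewrite mulrC ler_pdivlMr// => h.
by rewrite -exprMn; apply: lerXn2r;
  rewrite ?nnegrE ?mulr_ge0 ?seminorm_ge0 ?(ltW s0) ?(ltW Nx0).
Qed.

(** * Maximal ellipsoids and their contact points *)

(** A feasible [M] maps the Euclidean ball to an ellipsoid in the unit ball of [N], and a positive
    [\det M] is its relative volume. The feasible set is compact once matrices are flattened to row
    vectors. *)
Lemma exists_max_det (R : realType) (d : nat) (N : 'rV[R]_d -> R) :
  (0 < d)%N -> is_norm N ->
  exists M : 'M[R]_d, [/\ forall x, N (x *m M) ^+ 2 <= dotr x x, 0 < \det M
    & forall M', (forall x, N (x *m M') ^+ 2 <= dotr x x) -> \det M' <= \det M].
Proof.
move=> d0 hN; have [m m0 mN] := norm_ge_euclidean d0 hN; case: hN => ND NZ Ndef.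
pose K := [set v : 'rV[R]_(d * d) |
  forall x, N (x *m vec_mx v) ^+ 2 <= dotr x x].
have Kmx M : (forall x, N (x *m M) ^+ 2 <= dotr x x) -> K (mxvec M).
  by move=> h x; rewrite mxvecK.
have [C C0 NC] : exists2 C : R, 0 < C & forall x, N x <= C * `|x|.
  exact: seminorm_le_norm.
have normd (x : 'rV[R]_d) : `|x| ^+ 2 <= dotr x x.
  have [->|/mx_norm_neq0[[j i]]] := eqVneq `|x| 0; first by rewrite expr0n dotr_ge0.
  by rewrite [j]ord1 /= -[mx_norm x]/(`|x|) => ->;
    rewrite real_normK ?num_real ?sqr_dotr_coord.
(* A small multiple of the identity is feasible: the set is nonempty and the maximum positive. *)
have KC : K (mxvec (C^-1%:M)).
  apply: Kmx => x; rewrite mul_mx_scalar NZ gtr0_norm ?invr_gt0//.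
  apply: le_trans (normd x); apply: lerXn2r; rewrite ?nnegrE//.
    by rewrite mulr_ge0 ?seminorm_ge0// invr_ge0 ltW.
  by rewrite mulrC ler_pdivrMr// mulrC.
have cK : compact K.
  (* A row of a feasible matrix is the image of a basis vector: its [N] is at most 1, so its squared
     Euclidean norm is at most [m^-1]. *)
  apply: (subclosed_compact _ (@compact_box R (d * d) (1 + m^-1))).
    rewrite (_ : K = \bigcap_(x in [set: 'rV[R]_d])
      [set v | N (x *m vec_mx v) ^+ 2 <= dotr x x]); last first.
      by apply/seteqP; split=> v h x; [move=> _; exact: h|exact: h].
    apply: closed_bigI => x _.
    have cN : continuous (fun v : 'rV[R]_(d * d) => N (x *m vec_mx v)).
      apply: seminorm_continuous => [u v|a u]; first by rewrite linearD mulmxDr.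
      by rewrite linearZ -scalemxAr NZ.
    have cN2 : continuous (fun v : 'rV[R]_(d * d) => N (x *m vec_mx v) ^+ 2).
      by move=> v; exact: (continuousM (cN v) (cN v)).
    exact: (proj1 (continuous_closedP _) cN2 _ (@closed_le _ _)).
  move=> v Kv k; case/mxvec_indexP: k => i j.
  rewrite (_ : v 0 _ = row i (vec_mx v) 0 j); last by rewrite !mxE.
  apply: normr_le_sqr; apply: le_trans (sqr_dotr_coord _ _) _.
  rewrite -[leRHS]mul1r ler_pdivlMr// mulrC; apply: le_trans (mN _) _.
  by rewrite rowE; apply: le_trans (Kv _) _; rewrite dotr_delta_mx.
have [v /set_mem Kv vmax] := compact_EVT_max (ex_intro _ _ KC) cK
  (continuous_subspaceT (@det_vec_mx_continuous R d)).
exists (vec_mx v); split=> // [|M' /Kmx /mem_set /vmax].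
  apply: lt_le_trans (vmax _ (mem_set KC)).
  by rewrite mxvecK det_scalar exprn_gt0 ?invr_gt0.
by rewrite mxvecK.
Qed.

(* A maximizer of the determinant touches the unit sphere of N in some
   direction x that sees B nonnegatively: otherwise 1 + eta (B - c) would be a
   competitor of determinant > 1.  The functional <x, .> then has dual norm at
   most 2 because N <= |.| nearly coincide at x. *)
Lemma contact_point (R : realType) (d : nat) (N : 'rV[R]_d -> R) (B : 'M[R]_d) :
  is_norm N -> (forall x, N x ^+ 2 <= dotr x x) ->
  (forall D : 'M[R]_d, (forall x, N (x *m D) ^+ 2 <= dotr x x) -> \det D <= 1) ->
  0 < \tr B ->
  exists x, [/\ dotr x x = 1, 0 <= dotr (x *m B) x
    & forall y, `|dotr x y| <= 2 * N y].
Proof.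
move=> hN Nle Dle trB.
have d0 : (0 < d)%N.
  by case: d B trB {N hN Nle Dle} => // B; rewrite /mxtrace big_ord0 ltxx.
have d0R : 0 < d%:R :> R by rewrite ltr0n.
have [m m0 mN] := norm_ge_euclidean d0 hN; case: hN => ND NZ Ndef.
have Nge0 := seminorm_ge0 ND NZ.
(* Subtracting [c] keeps half of the trace, and [dotr (x *m B') x >= - c] is enough for the claim
   about [B] on unit vectors. *)
pose c : R := \tr B / (2 * d%:R).
have c0 : 0 < c by rewrite divr_gt0// mulr_gt0.
pose B' : 'M[R]_d := B - c%:M.
have trB' : 0 < \tr B'.
  have cd : c * d%:R = \tr B / 2 by rewrite /c; field; rewrite gt_eqF.
  by rewrite /B' linearB/= mxtrace_scalar subr_gt0 -mulr_natr cd; lra.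
have [e e0 eP] := det_perturb trB'.
have [C C1 CP] := dotr_mulmx_le B'.
have C0 : 0 < C by lra.
have [s [s0 s1 sm]] : exists s : R, [/\ 0 < s, s <= 1 & s <= 2 * m].
  exists (Num.min 1 (2 * m)).
  by split; rewrite ?ge_min ?lexx ?orbT// lt_min ltr01 mulr_gt0.
(* The bound by [2 * c] absorbs the second-order term of the squared length of [x *m D]; the bound
   by [s] yields [N x >= 1 - s / 8] for the duality step. *)
have [eta [eta0 etae etac etas]] : exists eta : R,
    [/\ 0 < eta, eta <= e, eta * C <= 2 * c & eta * (8 * C) <= s].
  have C8 : 0 < 8 * C by rewrite mulr_gt0.
  exists (Num.min e (Num.min (2 * c / C) (s / (8 * C)))).
  rewrite -(ler_pdivlMr _ _ C0) -(ler_pdivlMr _ _ C8).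
  split; rewrite ?ge_min ?ge_min ?lexx ?orbT//.
  by rewrite !lt_min e0 (divr_gt0 (mulr_gt0 _ c0) C0)//= (divr_gt0 s0 C8).
pose D : 'M[R]_d := 1%:M + eta *: B'.
have [x xD] : exists x, dotr x x < N (x *m D) ^+ 2.
  apply: contrapT => /forallNP h; have := eP _ eta0 etae.
  by rewrite ltNge Dle// => y; rewrite leNgt; apply/negP/h.
wlog x1 : x xD / dotr x x = 1.
  have xx : 0 < dotr x x.
    rewrite dotr_gt0; apply: contraPneq xD => ->.
    by apply/negP; rewrite mul0mx (seminorm0 NZ) expr0n/= -leNgt dotr_ge0.
  pose r := Num.sqrt (dotr x x).
  have r0 : 0 < r by rewrite sqrtr_gt0.
  have r2 : r ^+ 2 = dotr x x by rewrite sqr_sqrtr// ltW.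
  move=> /(_ (r^-1 *: x)); apply.
    rewrite dotrZl dotrZr mulrA -scalemxAl NZ exprMn real_normK ?num_real//.
    by rewrite -expr2 ltr_pM2l// exprn_gt0 ?invr_gt0.
  by rewrite dotrZl dotrZr mulrA -r2 -invfM -expr2 mulVf ?sqrf_eq0 ?gt_eqF.
have xDE : x *m D = x + eta *: (x *m B') by rewrite mulmxDr mulmx1 scalemxAr.
have CB : dotr (x *m B') (x *m B') <= C by rewrite (le_trans (CP x))// x1 mulr1.
exists x; split=> //.
  have := lt_le_trans xD (Nle _); rewrite xDE x1 !(dotrDl, dotrDr, dotrZl, dotrZr) x1.
  rewrite (dotrC x) /B' => h.
  have : dotr (x *m B) x = dotr (x *m B') x + c.
    by rewrite mulmxBr mul_mx_scalar dotrDl -scaleNr dotrZl x1; lra.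
  rewrite -/B' in h *; move=> ->.
  have h' : 0 < 2 * dotr (x *m B') x + eta * C.
    rewrite -(pmulr_rgt0 _ eta0).
    have : eta * (eta * dotr (x *m B') (x *m B')) <= eta * (eta * C).
      by rewrite !ler_pM2l.
    by nra.
  by lra.
have Nx : 1 - eta * C <= N x.
  have NB : N (x *m B') <= C.
    have : N (x *m B') ^+ 2 <= C ^+ 2.
      by apply: le_trans (Nle _) _; apply: le_trans CB _; nra.
    by rewrite ler_pXn2r// nnegrE// ltW.
  have ND1 : 1 < N (x *m D).
    by have := xD; rewrite x1 -[X in X < _](expr1n _ 2) ltr_pXn2r// nnegrE.
  have := ND x (eta *: (x *m B')); rewrite -xDE NZ (gtr0_norm eta0).
  have : eta * N (x *m B') <= eta * C by rewrite ler_pM2l.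
  lra.
(* If [N y < 1 / 2], passing from [x] to [x - s *: y] lowers the squared Euclidean norm to at most
   [1 - 3 s / 2], since [s <= 2 * m], while [N] stays at least [1 - 5 s / 8], whose square is
   larger. *)
have dual y : dotr x y = 1 -> 1 <= 2 * N y.
  move=> xy; rewrite leNgt; apply/negP => Ny.
  have yy : m * dotr y y < 1 / 4.
    by apply: le_lt_trans (mN y) _; have := Nge0 y; nra.
  have := ND (s *: y) (x - s *: y); rewrite addrC subrK NZ (gtr0_norm s0) => h.
  have := Nle (x - s *: y).
  rewrite -scaleNr !(dotrDl, dotrDr, dotrZl, dotrZr) (dotrC y) xy x1.
  rewrite scaleNr => h2.
  have syy : s * s * dotr y y <= s / 2.
    have := dotr_ge0 y; nra.
  have h3 : 1 - eta * C - s / 2 <= N (x - s *: y) by nra.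
  have : (1 - eta * C - s / 2) ^+ 2 <= N (x - s *: y) ^+ 2.
    by apply: lerXn2r => //; rewrite nnegrE//; lra.
  nra.
move=> y; have [->|xy] := eqVneq (dotr x y) 0.
  by rewrite normr0 mulr_ge0.
have := dual ((dotr x y)^-1 *: y); rewrite dotrZr mulVf// => /(_ erefl).
by rewrite NZ normfV mulrCA -ler_pdivrMl ?invr_gt0 ?normr_gt0// invrK mulr1.
Qed.

(** * Nearly orthogonal norming functionals *)

Lemma dotr_mulmxl (R : realType) (d n : nat) (x : 'rV[R]_n) (A : 'M[R]_(n, d)) y :
  dotr (x *m A) y = dotr x (y *m A^T).
Proof. by rewrite /dotr trmx_mul trmxK mulmxA. Qed.

Lemma dotr_suml (R : realType) (d n : nat) (F : 'I_n -> 'rV[R]_d) x :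
  dotr (\sum_i F i) x = \sum_i dotr (F i) x.
Proof. by rewrite dotrC dotr_sumr; apply: eq_bigr => i _; rewrite dotrC. Qed.

Lemma dotr_tensor (R : realType) (d : nat) (u x : 'rV[R]_d) :
  dotr (x *m (u^T *m u)) x = dotr x u ^+ 2.
Proof.
by rewrite mulmxA [x *m u^T]mx11_scalar mul_scalar_mx dotrZl -/(dotr x u) (dotrC u).
Qed.

Lemma near_orthogonal_sequence (R : realType) (d : nat) (N : 'rV[R]_d -> R) :
  (0 < d)%N -> is_norm N -> (forall x, N x ^+ 2 <= dotr x x) ->
  (forall D : 'M[R]_d, (forall x, N (x *m D) ^+ 2 <= dotr x x) -> \det D <= 1) ->
  forall n, exists u : nat -> 'rV[R]_d, forall t, (t < n)%N ->
    [/\ dotr (u t) (u t) = 1, forall y, `|dotr (u t) y| <= 2 * N y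
      & d%:R * \sum_(i < t) dotr (u t) (u i) ^+ 2 <= 2 * t%:R].
Proof.
move=> d0 hN Nle Dle; elim=> [|n [u uP]]; first by exists (fun=> 0).
have d0R : 0 < d%:R :> R by rewrite ltr0n.
pose A : 'M[R]_d := \sum_(i < n) (u i)^T *m u i.
(* The matrix [b / d - A] has trace [b - n], which must be positive. The choice [2 n] achieves this
   except at [n = 0], where [b] is 1 and the sum to be bounded is empty. *)
pose b : R := (n.*2 + (n == 0))%:R.
have trA : \tr A = n%:R.
  rewrite /A raddf_sum/= (eq_bigr (fun=> 1)) ?sumr_const ?card_ord// => i _.
  by rewrite mxtrace_mulC trace_mx11; have [] := uP i (ltn_ord i).
have [x [x1 xB xN]] : exists x, [/\ dotr x x = 1,
    0 <= dotr (x *m ((b / d%:R)%:M - A)) x & forall y, `|dotr x y| <= 2 * N y].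
  apply: contact_point => //; rewrite linearB/= mxtrace_scalar trA.
  rewrite -[_ *+ d]mulr_natr divfK ?gt_eqF// subr_gt0 ltr_nat.
  by rewrite -addnn -addnA -[X in (X < _)%N]addn0 ltn_add2l; case: (n).
exists (fun i => if i == n then x else u i) => t; rewrite ltnS leq_eqVlt.
have uE k v : (k <= n)%N ->
    \sum_(i < k) dotr v (if nat_of_ord i == n then x else u i) ^+ 2
    = \sum_(i < k) dotr v (u i) ^+ 2.
  move=> kn; apply: eq_bigr => i _; rewrite ltn_eqF//.
  exact: leq_trans (ltn_ord i) kn.
move=> /orP[/eqP ->|tn]; rewrite uE ?(ltnW tn)//; last first.
  by rewrite ltn_eqF//; exact: uP.
rewrite eqxx; split=> //.
move: xB; rewrite mulmxBr mul_mx_scalar dotrDl -scaleN1r !dotrZl x1 mulr1 mulN1r.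
rewrite /A mulmx_sumr dotr_suml (eq_bigr _ (fun i _ => dotr_tensor _ _)).
rewrite subr_ge0 ler_pdivlMr// mulrC /b; case: (n) => [|k].
  by rewrite big_ord0 !mulr0.
by rewrite addn0 -mul2n natrM.
Qed.

(** Adding [a t *: u t] to the partial sum [v] creates the cross term [2 * (a t * w)], where
    [w ^+ 2 <= 2 s t / d] by Cauchy-Schwarz. Splitting it as [a t ^+ 2 / 8 + 8 * w ^+ 2] loses an
    eighth of the diagonal and, in total, [8 s n (n - 1) / d <= s / 8]. *)
Lemma near_orthogonal_gram (R : realType) (d n : nat) (u : nat -> 'rV[R]_d) :
  (0 < d)%N -> (64 * (n * n.-1) <= d)%N ->
  (forall t, (t < n)%N -> dotr (u t) (u t) = 1 /\
    d%:R * \sum_(i < t) dotr (u t) (u i) ^+ 2 <= 2 * t%:R) ->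
  forall a : nat -> R, \sum_(i < n) a i ^+ 2 <=
    4 * dotr (\sum_(i < n) a i *: u i) (\sum_(i < n) a i *: u i).
Proof.
move=> d0 nd uP a; set s := \sum_(i < n) a i ^+ 2.
have d0R : 0 < d%:R :> R by rewrite ltr0n.
have s0 : 0 <= s by rewrite sumr_ge0// => i _; rewrite sqr_ge0.
have sP t : (t <= n)%N -> \sum_(i < t) a i ^+ 2 <= s.
  move=> tn; rewrite /s -(big_mkord xpredT (fun i => a i ^+ 2)).
  rewrite -(big_mkord xpredT (fun i => a i ^+ 2)) (big_cat_nat _ tn)//=.
  by rewrite lerDl sumr_ge0// => i _; rewrite sqr_ge0.
suff H t : (t <= n)%N -> 7 / 8 * \sum_(i < t) a i ^+ 2
      - 8 * s * (t%:R * (t%:R - 1)) / d%:R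
    <= dotr (\sum_(i < t) a i *: u i) (\sum_(i < t) a i *: u i).
  have := H n (leqnn _); rewrite -/s.
  have : 64 * (n%:R * (n%:R - 1)) / d%:R <= 1 :> R.
    rewrite ler_pdivrMr// mul1r; case: (n) nd => [|k]; first by rewrite mul0r mulr0 ltW.
    by rewrite -(@natr1 _ k) addrK natr1 -!natrM ler_nat.
  by nra.
elim: t => [_|t ih tn]; first by rewrite !big_ord0 mul0r !mulr0 mul0r subr0 dotr_ge0.
have [ut1 utS] := uP t tn.
rewrite !big_ord_recr/= !(dotrDl, dotrDr, dotrZl, dotrZr) ut1.
rewrite (dotrC (u t)); set v := \sum_(i < t) a i *: u i in ih *.
set w := dotr v (u t).
have w2 : d%:R * w ^+ 2 <= s * (2 * t%:R).
  have -> : w = \sum_(i < t) a i * dotr (u t) (u i).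
    by rewrite /w /v dotr_suml; apply: eq_bigr => i _; rewrite dotrZl dotrC.
  apply: le_trans (ler_pM _ _ (sP t (ltnW tn)) utS).
  - by rewrite [leRHS]mulrCA ler_pM2l// cauchy_schwarz_sum.
  - by rewrite sumr_ge0// => i _; rewrite sqr_ge0.
  - by rewrite mulr_ge0// sumr_ge0// => i _; rewrite sqr_ge0.
have {}w2 : w ^+ 2 <= s * (2 * t%:R) / d%:R by rewrite ler_pdivlMr// mulrC.
have am : - (a t ^+ 2 / 8 + 8 * w ^+ 2) <= 2 * (a t * w).
  by have := sqr_ge0 (a t + 8 * w); nra.
have := ih (ltnW tn); rewrite -(@natr1 _ t) addrK.
have -> : 8 * s * ((t%:R + 1) * t%:R) / d%:R
  = 8 * s * (t%:R * (t%:R - 1)) / d%:R + 8 * (s * (2 * t%:R) / d%:R) by ring.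
rewrite !mulrDr; nra.
Qed.

(** The hypothesis makes the Gram matrix [G] invertible, and [z = a *m U] with [a = e G^-1] solves
    the system. Its squared length is [dotr ev a]; combining [|a|^2 <= 4 |z|^2] with
    [|a - 4 e|^2 >= 0] bounds it. *)
Lemma gram_solve (R : realType) (d n : nat) (u : nat -> 'rV[R]_d) :
  (forall a : nat -> R, \sum_(i < n) a i ^+ 2 <=
    4 * dotr (\sum_(i < n) a i *: u i) (\sum_(i < n) a i *: u i)) ->
  forall e : nat -> R, exists2 z, forall i, (i < n)%N -> dotr (u i) z = e i
    & dotr z z <= 4 * \sum_(i < n) e i ^+ 2.
Proof.
move=> uP e; pose U : 'M[R]_(n, d) := \matrix_i u i.
have UP (a : 'rV[R]_n) : dotr a a <= 4 * dotr (a *m U) (a *m U).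
  pose a' (i : nat) : R := if insub i is Some j then a 0 j else 0.
  have a'E (i : 'I_n) : a' i = a 0 i by rewrite /a' valK.
  have aU : a *m U = \sum_(i < n) a' i *: u i.
    by rewrite mulmx_sum_row; apply: eq_bigr => i _; rewrite rowK a'E.
  rewrite aU; apply: le_trans (uP a'); rewrite dotrE le_eqVlt; apply/orP; left.
  by apply/eqP/eq_bigr => i _; rewrite a'E expr2.
pose G := U *m U^T.
have GE (a b : 'rV[R]_n) : dotr (a *m U) (b *m U) = dotr (a *m G) b.
  by rewrite (dotrC (a *m U)) dotr_mulmxl -mulmxA dotrC.
have Gu : G \in unitmx.
  rewrite -row_free_unit -kermx_eq0; apply/eqP/row_matrixP => i; rewrite row0.
  apply/eqP; rewrite -dotr_eq0 eq_le dotr_ge0 andbT; apply: le_trans (UP _) _.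
  by rewrite GE -row_mul mulmx_ker row0 /dotr mul0mx mxE mulr0.
pose ev : 'rV[R]_n := \row_i e i.
pose a := ev *m invmx G.
exists (a *m U) => [i ni|].
  have : a *m G = ev by rewrite /a -mulmxA mulVmx// mulmx1.
  move=> /rowP /(_ (Ordinal ni)); rewrite [RHS]mxE /= => <-.
  rewrite mulmxA dotrC /dotr !mxE; apply: eq_bigr => j _.
  by rewrite !mxE.
have zz : dotr (a *m U) (a *m U) = dotr ev a.
  by rewrite GE /a -(mulmxA _ (invmx G)) mulVmx// mulmx1.
have ee : dotr ev ev = \sum_(i < n) e i ^+ 2.
  by rewrite dotrE; apply: eq_bigr => i _; rewrite !mxE expr2.
have := UP a; have := dotr_ge0 (a - 4 *: ev).
rewrite -scaleNr !(dotrDl, dotrDr, dotrZl, dotrZr) (dotrC a) -ee zz; lra.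
Qed.

(** In the coordinates given by a maximal [M], the identity is the maximizer for [N']. Halving the
    contact functionals brings their dual norm to at most 1, so the targets become [2 * e i] and the
    squared length of [z] is at most [16 n]. *)
Lemma norming_near_orthogonal (R : realType) (d : nat) (N : 'rV[R]_d -> R) n :
  (0 < d)%N -> is_norm N -> (64 * (n * n.-1) <= d)%N ->
  exists w : nat -> 'rV[R]_d,
    (forall i x, (i < n)%N -> `|dotr (w i) x| <= N x) /\
    (forall e : nat -> R, (forall i, `|e i| = 1) ->
      exists2 x, forall i, (i < n)%N -> dotr (w i) x = e i
        & N x <= 4 * Num.sqrt n%:R).
Proof.
move=> d0 hN nd.
have [M [Nle detM Mmax]] := exists_max_det d0 hN.
have Mu : M \in unitmx by rewrite unitmxE unitfE gt_eqF.
pose N' (x : 'rV[R]_d) := N (x *m M).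
have hN' : is_norm N'.
  case: hN => ND NZ Ndef; split=> [x y|a x|x /Ndef xM].
  - by rewrite /N' mulmxDl.
  - by rewrite /N' -scalemxAl.
  by rewrite -[x](mulmxK Mu) xM mul0mx.
have Dle (D : 'M[R]_d) : (forall x, N' (x *m D) ^+ 2 <= dotr x x) -> \det D <= 1.
  move=> h; have : \det (D *m M) <= \det M.
    by apply: Mmax => x; rewrite mulmxA; exact: h.
  by rewrite det_mulmx ger_pMl.
have [u uP] := near_orthogonal_sequence d0 hN' Nle Dle n.
have ug := near_orthogonal_gram d0 nd
  (fun t tn => let: And3 h1 _ h3 := uP t tn in conj h1 h3).
exists (fun i => 2^-1 *: (u i *m (invmx M)^T)); split=> [i x ni|e e1].
  rewrite dotrZl dotr_mulmxl trmxK normrM normfV (@ger0_norm _ 2)//.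
  have [_ /(_ (x *m invmx M)) + _] := uP i ni.
  by rewrite /N' mulmxKV// ler_pdivrMl.
have [z ze zz] := gram_solve ug (fun i => 2 * e i).
exists (z *m M) => [i ni|].
  by rewrite dotrZl dotr_mulmxl trmxK mulmxK// ze// mulKf.
have N0 : 0 <= N (z *m M) by case: hN => ND NZ _; exact: (seminorm_ge0 ND NZ).
rewrite -(@ler_pXn2r _ 2)// ?nnegrE// ?mulr_ge0 ?sqrtr_ge0//.
rewrite exprMn sqr_sqrtr//; apply: le_trans (Nle z) _; apply: le_trans zz _.
rewrite (eq_bigr (fun=> 4)) => [|i _].
  by rewrite sumr_const card_ord -[4 *+ n]mulr_natr; nra.
by rewrite exprMn -[e i ^+ 2]real_normK ?num_real// e1 expr1n mulr1; lra.
Qed.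

(** * The adversary *)

(** Each sign of the adversary depends on all earlier ones through the player's replies; the
    recursion therefore builds the prefixes themselves. *)
Lemma prefix_recursion (T : Type) (F : seq T -> T) :
  exists e : nat -> T, forall t, e t = F (mkseq e t).
Proof.
pose E := fix E t := if t is t'.+1 then rcons (E t') (F (E t')) else [::].
exists (fun t => F (E t)) => t; congr F.
by elim: t => // t ih; rewrite mkseqS -ih.
Qed.

Section Requests.
Context (R : realType) (d : nat) (w : nat -> 'rV[R]_d) (L : R).
Implicit Types s : seq R.

(* The box [-L, L]^d only serves to make the request compact. *)
Definition request s : set 'rV[R]_d :=
  [set x : 'rV[R]_d | (forall i, `|x 0 i| <= L) /\
    forall i, (i < size s)%N -> dotr (w i) x = s`_i].

Definition requests s : seq (set 'rV[R]_d) :=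
  mkseq (fun t => request (take t.+1 s)) (size s).

Lemma size_requests s : size (requests s) = size s.
Proof. by rewrite size_mkseq. Qed.

Lemma nth_requests s t : (t < size s)%N ->
  nth set0 (requests s) t = request (take t.+1 s).
Proof. by move=> ts; rewrite nth_mkseq. Qed.

(** Prefixes of the request list depend only on prefixes of the values, so the player's position at
    time [t] is known before the next sign is chosen. *)
Lemma take_requests s t : (t <= size s)%N ->
  take t (requests s) = requests (take t s).
Proof.
move=> ts; apply: (@eq_from_nth _ set0) => [|i].
  by rewrite size_takel ?size_requests// size_takel.
rewrite size_takel ?size_requests// => it.
rewrite nth_take// !nth_requests ?size_takel ?(leq_trans it)//.
by rewrite take_takel.
Qed.

Lemma request_take s t : request s `<=` request (take t s).
Proof.
move=> x [xL xs]; split=> // i; rewrite size_take_min leq_min => /andP[it si].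
by rewrite nth_take// xs.
Qed.

Lemma convex_request s : request s !=set0 -> convex_body (request s).
Proof.
move=> s0; split=> //.
  apply: (subclosed_compact _ (@compact_box R d L)); last by move=> x [].
  apply: closedI; last first.
    apply: (@closed_bigI _ _ [set i | (i < size s)%N]
      (fun i => [set x : 'rV[R]_d | dotr (w i) x = s`_i])) => i _.
    apply: (proj1 (continuous_closedP _) _ _ (@closed_eq _ _)).
    rewrite (_ : dotr _ = fun x : 'rV[R]_d => \sum_j w i 0 j * x 0 j); last first.
      by apply/funext => x; rewrite dotrE.
    apply: continuous_big => [|j _ x]; first exact: add_continuous.
    exact: (continuousM (@cst_continuous _ _ _ x) (@coord_continuous _ _ _ _ _ x)).
  by apply: compact_closed; [exact: norm_hausdorff|exact: compact_box].
move=> x y l /set_mem[xL xs] /set_mem[yL ys]; apply/mem_set.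
rewrite /conv/=; have l0 : 0 <= l%:num by [].
have l1 : 0 <= 1 - l%:num by rewrite subr_ge0.
split=> [i|i si].
  rewrite !mxE; apply: le_trans (ler_normD _ _) _; rewrite !normrM.
  rewrite (ger0_norm l0) -[unstable.onem _]/(1 - l%:num) (ger0_norm l1).
  by have := ler_wpM2l l0 (xL i); have := ler_wpM2l l1 (yL i); lra.
by rewrite dotrDr !dotrZr xs// ys// -[unstable.onem _]/(1 - l%:num); ring.
Qed.

End Requests.

(** The box must be fixed before the signs are known. One [L] suffices because there are only
    finitely many sign patterns of length [n]. *)
Lemma bounded_sign_solutions (R : realType) (d n : nat) (N : 'rV[R]_d -> R)
    (w : nat -> 'rV[R]_d) (B : R) :
  (forall e : nat -> R, (forall i, `|e i| = 1) ->
    exists2 x, forall i, (i < n)%N -> dotr (w i) x = e i & N x <= B) ->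
  exists L : R, forall e : nat -> R, (forall i, `|e i| = 1) ->
    exists x, [/\ forall i, (i < n)%N -> dotr (w i) x = e i, N x <= B
      & forall i, `|x 0 i| <= L].
Proof.
move=> sol; pose sg (b : {ffun 'I_n -> bool}) (i : nat) : R :=
  if insub i is Some j then (-1) ^+ b j else 1.
have sg1 b i : `|sg b i| = 1.
  by rewrite /sg; case: insubP => [j _ _|_]; rewrite ?normrX ?normrN1 ?expr1n ?normr1.
have /choice[x xP] : forall b, exists x,
    (forall i, (i < n)%N -> dotr (w i) x = sg b i) /\ N x <= B.
  by move=> b; have [x xs xB] := sol _ (sg1 b); exists x.
exists (\sum_b \sum_i `|x b 0 i|) => e e1.
pose b := [ffun i : 'I_n => e i == -1].
exists (x b); have [xb xB] := xP b; split=> // [i ni|i].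
  rewrite xb// /sg insubT /b ffunE/=; have := e1 i.
  case: eqVneq => [->//|en1 /eqP]; rewrite eqr_norml (negbTE en1) orbF.
  by move=> /andP[/eqP ->].
rewrite (bigD1 b)//= (bigD1 i)//= -addrA lerDl addr_ge0// sumr_ge0// => c _.
by rewrite sumr_ge0.
Qed.

(* The adversary fixes the value of the t-th functional to the sign opposite to
   its value at the current position, which costs the player at least 1 at each
   step; the offline player goes at once to the common point of all requests. *)
Lemma nested_chasing_lower_bound (R : realType) (d n : nat) (N : 'rV[R]_d -> R)
    (w : nat -> 'rV[R]_d) (B : R) :
  (0 < n)%N -> N 0 = 0 ->
  (forall i x, (i < n)%N -> `|dotr (w i) x| <= N x) ->
  (forall e : nat -> R, (forall i, `|e i| = 1) ->
    exists2 x, forall i, (i < n)%N -> dotr (w i) x = e i & N x <= B) ->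
  ((n%:R / B)%:E <= nested_chasing_ratio N)%E.
Proof.
move=> n0 N0 wN /bounded_sign_solutions[L sol].
have Nge0 x : 0 <= N x := le_trans (normr_ge0 _) (wN 0%N x n0).
apply: le_ereal_inf_tmp => _ [A hA <-].
(* The value of [A] on the empty list is arbitrary, so the start 0 is put in by hand. *)
pose pos s := if s is [::] then 0 else A (requests w L s).
have [e eP] := prefix_recursion (fun s : seq R =>
  if 0 <= dotr (w (size s)) (pos s) then - (1 : R) else 1).
have e1 i : `|e i| = 1 by rewrite eP; case: ifP => _; rewrite ?normrN normr1.
have [z [ze zB zL]] := sol e e1.
have zreq m : (m <= n)%N -> request w L (mkseq e m) z.
  move=> mn; split=> // i; rewrite size_mkseq => im.
  by rewrite nth_mkseq// ze// (leq_trans im).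
have takee t m : (t <= m)%N -> take t (mkseq e m) = mkseq e t.
  by move=> tm; rewrite /mkseq -map_take take_iota (minn_idPl tm).
have nest m : (m <= n)%N -> nested_requests (requests w L (mkseq e m)).
  move=> mn; split=> t; rewrite size_requests size_mkseq => tm.
    rewrite nth_requests ?size_mkseq// takee//; apply: convex_request.
    by exists z; apply: zreq; exact: leq_trans mn.
  rewrite !nth_requests ?size_mkseq// ?(ltnW tm)// !takee// ?(ltnW tm)//.
  by rewrite -(takee t.+1 t.+2)//; exact: request_take.
pose ks := requests w L (mkseq e n).
have sks : size ks = n by rewrite size_requests size_mkseq.
have trajE t : (t <= n)%N -> trajectory A ks t = pos (mkseq e t).
  move=> tn; rewrite /trajectory /ks; case: t tn => // t tn.
  by rewrite take_requests ?size_mkseq// takee.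
have trajP t : (t < n)%N -> dotr (w t) (pos (mkseq e t.+1)) = e t.
  move=> tn; have := hA (requests w L (mkseq e t.+1)).
  rewrite size_requests size_mkseq => /(_ isT (nest _ tn)).
  rewrite -nth_last size_requests size_mkseq nth_requests ?size_mkseq// takee//.
  by case=> _ /(_ t); rewrite size_mkseq nth_mkseq// => /(_ (ltnSn t)).
have cost : n%:R <= path_cost N (size ks) (trajectory A ks).
  rewrite /path_cost sks -[X in X%:R <= _]card_ord -sumr_const.
  apply: ler_sum => t _; apply: le_trans (wN t _ (ltn_ord t)).
  rewrite !trajE// ?(ltnW (ltn_ord t))// -[_ - _]/(_ + - _) -scaleN1r.
  rewrite dotrDr dotrZr trajP//.
  rewrite eP size_mkseq; case: ifPn => [h|].
    by rewrite -normrN; apply: le_trans (ler_norm _); lra.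
  by rewrite -ltNge => h; apply: le_trans (ler_norm _); lra.
have pc_ge0 y : 0 <= path_cost N (size ks) y by rewrite sumr_ge0.
have optB : opt N ks <= B.
  apply: le_trans zB; pose y t := if t is 0%N then 0 else z.
  have -> : N z = path_cost N (size ks) y.
    rewrite /path_cost sks; case: (n) n0 => // k _.
    by rewrite big_ord_recl/= subr0 big1 ?addr0// => i _; rewrite subrr.
  apply: ge_inf; first by exists 0 => _ [y' _ <-].
  exists y => //; split=> // t; rewrite sks => tn.
  by rewrite /ks nth_requests ?size_mkseq// takee//; exact: zreq.
have opt0 : 0 <= opt N ks.
  apply: lb_le_inf; last by move=> _ [y _ <-].
  exists (path_cost N (size ks) (fun t => if t is 0%N then 0 else z)).
  eexists; last by reflexivity.
  split=> // t; rewrite sks => tn.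
  by rewrite /ks nth_requests ?size_mkseq// takee//; exact: zreq.
apply: le_trans (ereal_sup_ubound _); last by exists ks => //; exact: nest.
have n0R : 0 < n%:R :> R by rewrite ltr0n.
(* If the optimum is 0, the quotient is infinite because the cost is at least [n > 0]. *)
rewrite inver; case: eqVneq => [_|optn0].
  by rewrite gt0_muley ?leey// lte_fin (lt_le_trans n0R).
have opt_gt0 : 0 < opt N ks by rewrite lt0r optn0.
rewrite -EFinM lee_fin; apply: ler_pM => //.
  by rewrite invr_ge0; exact: le_trans optB.
by rewrite lef_pV2// posrE (lt_le_trans opt_gt0).
Qed.

(** * Lower bounds for lp norms and for general norms *)

(** This is Young's inequality for the product of [y] and 1, with [q] and its conjugate exponent. *)
Lemma powR_tangent (R : realType) (y q : R) : 0 <= y -> 1 <= q ->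
  q * (y - 1) + 1 <= y `^ q.
Proof.
move=> y0; rewrite le_eqVlt => /orP[/eqP<-|q1]; first by rewrite powRr1//; lra.
have q0 : 0 < q by lra.
have p0 : 0 < 1 - q^-1 by rewrite subr_gt0 invf_lt1.
have := @conjugate_powR R y 1 q (1 - q^-1)^-1 y0 ler01 q0.
rewrite invr_gt0 invrK => /(_ p0); rewrite powR1 mulr1 addrC subrK => /(_ erefl).
rewrite mul1r -(ler_pM2l q0) mulrDr mulrCA divff ?gt_eqF// mulr1.
by rewrite mulrBr divff ?gt_eqF// mulr1; lra.
Qed.

(* Both sides are homogeneous: after scaling the mean of y to 1, sum the
   tangent inequality at 1. *)
Lemma power_mean (R : realType) (n : nat) (y : 'I_n -> R) (q : R) :
  (forall i, 0 <= y i) -> 1 <= q ->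
  (\sum_i y i) `^ q <= n%:R `^ (q - 1) * \sum_i y i `^ q.
Proof.
move=> y0 q1; set S := \sum_i y i.
have q0 : 0 < q by lra.
have S0 : 0 <= S by rewrite sumr_ge0.
move: S0; rewrite le_eqVlt => /orP[/eqP<-|S0].
  by rewrite powR0 ?gt_eqF// mulr_ge0 ?powR_ge0// sumr_ge0// => i _; rewrite powR_ge0.
have n0 : 0 < n%:R :> R.
  rewrite ltr0n lt0n; apply: contraTneq S0 => n0.
  by rewrite /S; move: y y0 {S}; rewrite n0 => y _; rewrite big_ord0 ltxx.
pose m := S / n%:R.
have m0 : 0 < m by rewrite divr_gt0.
have sum_ge : n%:R <= \sum_i (y i / m) `^ q.
  apply: (@le_trans _ _ (\sum_i (q * (y i / m - 1) + 1))).
    rewrite big_split/= -mulr_sumr sumrB -mulr_suml -/S !sumr_const card_ord.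
    have -> : S / m = n%:R by rewrite /m invf_div mulrCA divff ?gt_eqF// mulr1.
    lra.
  by apply: ler_sum => i _; apply: powR_tangent => //; rewrite divr_ge0// ltW.
have E : \sum_i (y i / m) `^ q = (\sum_i y i `^ q) / m `^ q.
  rewrite mulr_suml; apply: eq_bigr => i _.
  rewrite powRM// ?invr_ge0 ?(ltW m0)// -powR_inv1 ?(ltW m0)// powRAC.
  by rewrite powR_inv1 ?powR_ge0.
rewrite E ler_pdivlMr ?powR_gt0// in sum_ge.
have -> : S = m * n%:R by rewrite divfK ?gt_eqF.
rewrite powRM ?(ltW m0) ?(ltW n0)//.
have <- : n%:R * n%:R `^ (q - 1) = n%:R `^ q :> R by rewrite mulr_powRB1// ltW.
by rewrite mulrA mulrC ler_pM2l ?powR_gt0// mulrC.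
Qed.

Section LpNorm.
Context (R : realType) (d : nat).

Lemma lp_norm0 (p : \bar R) : (1 <= p)%E -> lp_norm p (0 : 'rV[R]_d) = 0.
Proof.
case: p => [r|_|//] /=; last first.
  by elim/big_ind: _ => // [a b -> ->|i _]; rewrite ?maxxx// mxE normr0.
rewrite lee_fin => r1; have r0 : r != 0 by rewrite gt_eqF//; lra.
rewrite big1 => [|i _]; first by rewrite powR0// invr_eq0.
by rewrite mxE normr0 powR0.
Qed.

Lemma coord_le_lp_norm (p : \bar R) (x : 'rV[R]_d) i :
  (1 <= p)%E -> `|x 0 i| <= lp_norm p x.
Proof.
case: p => [r|_|//] /=; last first.
  exact: le_bigmax.
rewrite lee_fin => r1; have r0 : 0 < r by lra.
have -> : `|x 0 i| = (`|x 0 i| `^ r) `^ r^-1.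
  by rewrite -powRrM divff ?gt_eqF// powRr1.
apply: ge0_ler_powR; rewrite ?nnegrE ?powR_ge0 ?invr_ge0 ?(ltW r0)//.
  by rewrite sumr_ge0// => j _; rewrite powR_ge0.
by rewrite (bigD1 i)//= lerDl sumr_ge0// => j _; rewrite powR_ge0.
Qed.

Lemma lp_norm_sign (p : \bar R) (x : 'rV[R]_d) : (0 < d)%N -> (1 <= p)%E ->
  (forall i, `|x 0 i| = 1) -> lp_norm p x <= d%:R `^ (fine (p^-1)%E).
Proof.
move=> d0 + x1; case: p => [r|_|//] /=.
  rewrite lee_fin => r1; rewrite fine_invr (eq_bigr (fun=> 1)) => [|i _].
    by rewrite sumr_const card_ord.
  by rewrite x1 powR1.
by rewrite powRr0; apply/bigmax_leP; split=> // i _; rewrite x1.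
Qed.

End LpNorm.

Lemma cube_lower_bound (R : realType) (d : nat) (p : \bar R) :
  (0 < d)%N -> (1 <= p)%E ->
  ((d%:R `^ (1 - fine (p^-1)%E))%:E <= nested_chasing_ratio (lp_norm (d := d) p))%E.
Proof.
move=> d0 p1; have d0R : 0 < d%:R :> R by rewrite ltr0n.
have -> : d%:R `^ (1 - fine (p^-1)%E) = d%:R / d%:R `^ fine (p^-1)%E :> R.
  by rewrite powRB ?(gt_eqF d0R) ?implybT// powRr1 ?ltW.
pose w i : 'rV[R]_d := if insub i is Some j then delta_mx 0 j else 0.
have wE (i : 'I_d) x : dotr (w i) x = x 0 i.
  rewrite /w valK dotrE (bigD1 i)//= big1 ?addr0 => [|j /negbTE ji].
    by rewrite mxE !eqxx mul1r.
  by rewrite mxE ji andbF mul0r.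
apply: (nested_chasing_lower_bound (w := w)) => //.
- exact: lp_norm0.
- by move=> i x id; rewrite (wE (Ordinal id)) coord_le_lp_norm.
move=> e e1; exists (\row_i e i) => [i id|].
  by rewrite (wE (Ordinal id)) mxE.
by apply: lp_norm_sign => // i; rewrite mxE.
Qed.

(** * Hadamard matrices, the case of exponent at most 2, and general norms *)

(** Sylvester's doubling: the off-diagonal blocks of the product cancel and the diagonal blocks
    double. *)
Lemma hadamard_matrix (R : realType) k : exists H : 'M[R]_(2 ^ k),
  (forall i j, `|H i j| = 1) /\ H *m H^T = (2 ^ k)%:R%:M.
Proof.
elim: k => [|k [H [H1 HH]]].
  exists 1%:M; split=> [i j|]; last by rewrite trmx1 mulmx1.
  by rewrite mxE !ord1 eqxx normr1.
rewrite expnS mul2n -addnn; exists (block_mx H H H (- H)); split=> [i j|].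
  rewrite mxE; case: fintype.split => a; rewrite mxE.
    by case: fintype.split => b; exact: H1.
  by case: fintype.split => b; rewrite ?mxE ?normrN; exact: H1.
rewrite tr_block_mx mulmx_block linearN/= !mulmxN !mulNmx opprK subrr HH.
by rewrite -raddfD/= -natrD -scalar_mx_block.
Qed.

Lemma lp_norm_row_mx0 (R : realType) (n m : nat) (r : R) (y : 'rV[R]_n) :
  r != 0 -> lp_norm r%:E (row_mx y (0 : 'rV_m)) = lp_norm r%:E y.
Proof.
move=> r0; rewrite /lp_norm big_split_ord/= [X in _ + X]big1 => [|i _].
  by rewrite addr0; congr (_ `^ _); apply: eq_bigr => i _; rewrite row_mxEl.
by rewrite row_mxEr mxE normr0 powR0.
Qed.

Lemma lp_norm_lsubmx (R : realType) (n m : nat) (r : R) (x : 'rV[R]_(n + m)) :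
  0 <= r -> lp_norm r%:E (lsubmx x) <= lp_norm r%:E x.
Proof.
move=> r0; have S0 k (z : 'rV[R]_k) : 0 <= \sum_i `|z 0 i| `^ r.
  by rewrite sumr_ge0// => i _; rewrite powR_ge0.
apply: ge0_ler_powR; rewrite ?nnegrE ?invr_ge0//.
rewrite [leRHS]big_split_ord/= -[leLHS]addr0; apply: lerD.
  by apply: ler_sum => i _; rewrite mxE.
by rewrite sumr_ge0// => i _; rewrite powR_ge0.
Qed.

(** The power mean inequality with exponent [r]; it bounds the dual norm of a sign vector. *)
Lemma sum_normr_le_lp_norm (R : realType) (n : nat) (r : R) (x : 'rV[R]_n) :
  1 <= r -> \sum_i `|x 0 i| <= n%:R `^ (1 - r^-1) * lp_norm r%:E x.
Proof.
move=> r1; have r0 : 0 < r by lra.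
have S0 : 0 <= \sum_i `|x 0 i| by rewrite sumr_ge0.
have -> : \sum_i `|x 0 i| = ((\sum_i `|x 0 i|) `^ r) `^ r^-1.
  by rewrite -powRrM divff ?gt_eqF// powRr1.
have -> : n%:R `^ (1 - r^-1) = (n%:R `^ (r - 1)) `^ r^-1 :> R.
  by rewrite -powRrM mulrBl mul1r divff ?gt_eqF.
rewrite -powRM ?powR_ge0//; last by rewrite sumr_ge0// => i _; rewrite powR_ge0.
apply: ge0_ler_powR; rewrite ?nnegrE ?powR_ge0 ?invr_ge0 ?(ltW r0)//.
  by rewrite mulr_ge0 ?powR_ge0// sumr_ge0// => i _; rewrite powR_ge0.
exact: power_mean.
Qed.

(** The power mean inequality for the numbers [|x_i|^r] with exponent [2 / r], which is at least 1
    as [r <= 2]. *)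
Lemma lp_norm_le_dotr (R : realType) (n : nat) (r : R) (x : 'rV[R]_n) :
  1 <= r <= 2 -> lp_norm r%:E x ^+ 2 <= n%:R `^ (2 / r - 1) * dotr x x.
Proof.
move=> /andP[r1 r2]; have r0 : 0 < r by lra.
have S0 : 0 <= \sum_i `|x 0 i| `^ r by rewrite sumr_ge0// => i _; rewrite powR_ge0.
rewrite /lp_norm -powR_mulrn ?powR_ge0// -powRrM (mulrC r^-1).
have -> : dotr x x = \sum_i (`|x 0 i| `^ r) `^ (2 / r).
  rewrite dotrE; apply: eq_bigr => i _; rewrite -powRrM mulrCA divff ?gt_eqF//.
  by rewrite mulr1 powR_mulrn// real_normK ?num_real// expr2.
by apply: power_mean => [i|]; rewrite ?powR_ge0// ler_pdivlMr ?mul1r.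
Qed.

Lemma hadamard_lower_bound (R : realType) (d : nat) (r : R) :
  (0 < d)%N -> 1 <= r <= 2 ->
  ((1 / 2 * Num.sqrt d%:R)%:E <= nested_chasing_ratio (lp_norm (d := d) r%:E))%E.
Proof.
move=> d0 r12; have /andP[r1 r2] := r12; have r0 : 0 < r by lra.
have [nd dn] : (2 ^ trunc_log 2 d <= d)%N /\ (d < 2 ^ (trunc_log 2 d).+1)%N.
  by have /andP[] := trunc_log_bounds (ltnSn 1) d0.
have [H [H1 HH]] := hadamard_matrix R (trunc_log 2 d).
rewrite expnS in dn; have : (0 < 2 ^ trunc_log 2 d)%N by rewrite expn_gt0.
move: (2 ^ _)%N nd dn H H1 HH => n nd dn H H1 HH n0.
have n0R : 0 < n%:R :> R by rewrite ltr0n.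
(* [c] bounds the dual norm of the rows of [H], which are scaled by its inverse and padded with
   zeros in the other [d - n] coordinates. *)
pose c : R := n%:R `^ (1 - r^-1); have c0 : 0 < c by rewrite powR_gt0.
suff lb : ((n%:R / Num.sqrt n%:R)%:E <= nested_chasing_ratio (lp_norm (d := d) r%:E))%E.
  apply: le_trans lb; rewrite lee_fin.
  rewrite -{1}[n%:R](sqr_sqrtr (ltW n0R)) expr2 mulfK ?sqrtr_eq0 -?ltNge//.
  rewrite div1r ler_pdivrMl// -[X in X * _](ger0_norm (ler0n _ 2)) -sqrtr_sqr.
  by rewrite -sqrtrM// ler_sqrt// -natrX -natrM ler_nat; lia.
move: (subnKC nd) => <-; move: (d - n)%N => m {d d0 nd dn}.
pose w i : 'rV[R]_(n + m) :=
  if insub i is Some j then c^-1 *: row_mx (row j H) 0 else 0.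
have wE (i : 'I_n) x : dotr (w i) x = c^-1 * dotr (row i H) (lsubmx x).
  rewrite /w valK dotrZl; congr (_ * _).
  by rewrite /dotr -{1}[x]hsubmxK tr_row_mx mul_row_col mul0mx addr0.
apply: (nested_chasing_lower_bound (w := w)) => //.
- exact: lp_norm0.
- move=> i x ni; rewrite (wE (Ordinal ni)) normrM normfV (gtr0_norm c0).
  rewrite mulrC ler_pdivrMr// mulrC.
  apply: le_trans (ler_wpM2l (ltW c0) (lp_norm_lsubmx _ (ltW r0))).
  apply: le_trans (sum_normr_le_lp_norm _ r1); rewrite dotrE.
  apply: le_trans (ler_norm_sum _ _ _) _; apply: ler_sum => j _.
  by rewrite normrM !mxE H1 mul1r.
move=> e e1; pose ev : 'rV[R]_n := \row_i e i.
(* Since [H *m H^T] is [n] times the identity, [y] solves the scaled system and has Euclidean length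
   [c]. The powers of [n] then add up to exponent 1. *)
pose y : 'rV[R]_n := (c / n%:R) *: (ev *m H).
exists (row_mx y 0) => [i ni|].
  rewrite (wE (Ordinal ni)) row_mxKl dotrC dotrZl dotr_mulmxl.
  have -> : row (Ordinal ni) H *m H^T = n%:R *: delta_mx 0 (Ordinal ni).
    by rewrite -row_mul HH rowE mul_mx_scalar.
  rewrite dotrZr dotrC dotrE (bigD1 (Ordinal ni))//= big1 => [|j /negbTE ji].
    rewrite !mxE !eqxx mul1r addr0 mulrA divfK ?gt_eqF//.
    by rewrite mulrA mulVf ?gt_eqF// mul1r.
  by rewrite mxE ji andbF mul0r.
rewrite lp_norm_row_mx0 ?gt_eqF// -(@ler_pXn2r _ 2)// ?nnegrE ?sqrtr_ge0 ?powR_ge0//.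
rewrite sqr_sqrtr ?(ltW n0R)//; apply: le_trans (lp_norm_le_dotr _ r12) _.
have ee : dotr ev ev = n%:R.
  rewrite dotrE (eq_bigr (fun=> 1)) ?sumr_const ?card_ord// => i _.
  by rewrite mxE -expr2 -real_normK ?num_real// e1 expr1n.
have -> : dotr y y = c ^+ 2.
  rewrite dotrZl dotrZr dotr_mulmxl -mulmxA HH mul_mx_scalar dotrZr ee.
  by field; rewrite gt_eqF.
rewrite -powR_mulrn ?powR_ge0// -powRrM -powRD ?(gt_eqF n0R) ?implybT//.
rewrite (_ : 2 / r - 1 + _ = 1); last by field; rewrite gt_eqF.
by rewrite powRr1 ?(ltW n0R).
Qed.

(** The coordinate bound is the larger term exactly when its exponent is at least 1/2 (or [d = 1]);
    otherwise [p] is finite and below 2, where Hadamard rows apply. *)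
Lemma lp_lower_bound (R : realType) (d : nat) (p : \bar R) :
  (0 < d)%N -> (1 <= p)%E ->
  ((1 / 2 * Num.max (d%:R `^ (1 - fine (p^-1)%E)) (Num.sqrt d%:R))%:E
     <= nested_chasing_ratio (lp_norm (d := d) p))%E.
Proof.
move=> d0 p1; have d1 : 1 <= d%:R :> R by rewrite ler1n.
rewrite -powR12_sqrt ?ler0n//.
have [h|h] := leP (2^-1) (1 - fine (p^-1)%E).
  rewrite max_l ?ler_powR//; apply: le_trans (cube_lower_bound d0 p1).
  by rewrite lee_fin div1r ler_pdivrMl// ler_peMl ?powR_ge0// ler1n.
rewrite max_r ?ler_powR// ?(ltW h)//.
case: p p1 h => [r|_ h|//]; last first.
  by exfalso; move: h; rewrite /= subr0; lra.
rewrite lee_fin fine_invr => r1 h; have r0 : 0 < r by lra.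
have r2 : r <= 2.
  have : 2^-1 < r^-1 by lra.
  by rewrite ltf_pV2 ?posrE// => /ltW.
by rewrite powR12_sqrt ?ler0n//; apply: hadamard_lower_bound; rewrite // r1.
Qed.

(* The bound obtained is in fact of order d^(1/4). *)
Lemma sixth_root_lower_bound (R : realType) (d : nat) (N : 'rV[R]_d -> R) :
  (0 < d)%N -> is_norm N ->
  ((1 / 12 * d%:R `^ (1 / 6))%:E <= nested_chasing_ratio N)%E.
Proof.
move=> d0 hN; pose P n := (64 * (n * n.-1) <= d)%N.
have exP : exists n, P n by exists 1%N; rewrite /P muln0.
have Ple n : P n -> (n <= d.+1)%N by rewrite /P; nia.
have [n Pn nmax] := ex_maxnP exP Ple.
have n0 : (0 < n)%N by apply: nmax; rewrite /P muln0.
(* By maximality [n + 1] fails, so [d < 64 n (n + 1) <= 128 n^2]. *)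
have dn : (d <= 128 * n ^ 2)%N.
  have : ~~ P n.+1 by apply/negP => /nmax; rewrite ltnn.
  by rewrite /P -ltnNge /=; nia.
have n1R : 1 <= n%:R :> R by rewrite ler1n.
have n0R : 0 < n%:R :> R by rewrite ltr0n.
have [w [wN wsol]] := norming_near_orthogonal d0 hN Pn.
have N0 : N 0 = 0 by case: hN => _ NZ _; exact: (seminorm0 NZ).
apply: le_trans (nested_chasing_lower_bound n0 N0 wN wsol).
pose s : R := Num.sqrt n%:R; have s0 : 0 < s by rewrite sqrtr_gt0.
have s2 : s ^+ 2 = n%:R by rewrite sqr_sqrtr ?ltW.
(* Indeed [128 n^2 <= 729 n^3 = (3 s)^6]. With the ratio [n / (4 s) = s / 4] this gives the constant
   [1 / 12]. *)
have root : d%:R `^ (1 / 6) <= 3 * s.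
  have -> : 3 * s = ((3 * s) ^+ 6) `^ (1 / 6).
    rewrite -powR_mulrn; last by rewrite mulr_ge0// ltW.
    by rewrite -powRrM (_ : 6%:R * (1 / 6) = 1) ?powRr1 ?mulr_ge0 ?(ltW s0)//; field.
  apply: ge0_ler_powR; rewrite ?nnegrE ?ler0n ?exprn_ge0 ?mulr_ge0 ?(ltW s0)//.
  apply: (@le_trans _ _ (128 * n%:R ^+ 2)); first by rewrite -natrX -natrM ler_nat.
  have -> : (3 * s) ^+ 6 = 729 * n%:R ^+ 3 by rewrite -s2; ring.
  rewrite [n%:R ^+ 3]exprS; have := exprn_ge0 2 (ltW n0R); nra.
rewrite lee_fin -/s -s2 expr2 -[4 * s]mulrC -mulf_div divff ?gt_eqF// mul1r; lra.
Qed.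

Theorem theorem1p2 (R : realType) :
  exists c : R, 0 < c /\
    (forall (d : nat) (p : \bar R), (0 < d)%N -> (1 <= p)%E ->
      ((c * Num.max (d%:R `^ (1 - fine (p^-1)%E)) (Num.sqrt d%:R))%:E
         <= nested_chasing_ratio (lp_norm (d := d) p))%E) /\
    (forall (d : nat) (N : 'rV[R]_d -> R), (0 < d)%N -> is_norm N ->
      ((c * d%:R `^ (1 / 6))%:E <= nested_chasing_ratio N)%E).
Proof.
exists (1 / 12); split; first by lra.
split=> [d p d0 p1|d N d0 hN]; last exact: sixth_root_lower_bound.
apply: le_trans (lp_lower_bound d0 p1); rewrite lee_fin ler_wpM2r//; lra.
Qed.
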